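(* Let $\Gamma$ be a hyperbolic group such that $\mathrm{Out}(\Gamma)$ is infinite, and let $S$ be any finite generating set of $\Gamma$. Then $\mathcal{B}_S=S\cup\{ss'\mid s,s'\in S,\ s\neq s'\}$ is a test subset: for every sequence $(\phi_n)$ of distinct elements of $\mathrm{Out}(\Gamma)$ there is $b\in\mathcal{B}_S$ with $\limsup_n l_S(\phi_n(b))=\infty$.
   Context: $l_S(\gamma)=\min_{g\in\Gamma}|g\gamma g^{-1}|_S$ is the translation length of $\gamma$ on the Cayley graph $C_S(\Gamma)$ (well defined on outer automorphism classes), $|\cdot|_S$ the word length. *)

(* Defs.v *)
From Stdlib Require Import List Arith ZArith.
Import ListNotations.
Set Implicit Arguments.

Section GroupDefs.
Variables (G : Type) (mul : G -> G -> G) (inv : G -> G) (e : G).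

Definition is_group : Prop :=
  (forall x y z, mul x (mul y z) = mul (mul x y) z) /\
  (forall x, mul e x = x) /\ (forall x, mul x e = x) /\
  (forall x, mul (inv x) x = e) /\ (forall x, mul x (inv x) = e).

Definition wprod (l : list G) : G := fold_right mul e l.

Definition word_len_le (S : list G) (g : G) (n : nat) : Prop :=
  exists l : list G, length l <= n /\
    Forall (fun x => In x S \/ In (inv x) S) l /\ wprod l = g.

Definition generates (S : list G) : Prop := forall g, exists n, word_len_le S g n.

Definition is_word_len (S : list G) (g : G) (n : nat) : Prop :=
  word_len_le S g n /\ forall m, word_len_le S g m -> n <= m.

Definition is_dist (S : list G) (x y : G) (n : nat) : Prop :=
  is_word_len S (mul (inv x) y) n.

(* Gromov hyperbolicity of the Cayley graph (4-point condition on vertices,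
   written with twice the Gromov products):
   (x|y)_w >= min((x|z)_w, (y|z)_w) - delta. *)
Definition hyperbolic_wrt (S : list G) : Prop :=
  exists delta : nat, forall x y z w (dxw dyw dzw dxy dxz dyz : nat),
    is_dist S x w dxw -> is_dist S y w dyw -> is_dist S z w dzw ->
    is_dist S x y dxy -> is_dist S x z dxz -> is_dist S y z dyz ->
    (Z.of_nat dxw + Z.of_nat dyw - Z.of_nat dxy >=
     Z.min (Z.of_nat dxw + Z.of_nat dzw - Z.of_nat dxz)
           (Z.of_nat dyw + Z.of_nat dzw - Z.of_nat dyz) - 2 * Z.of_nat delta)%Z.

Definition hyperbolic_group : Prop :=
  exists S : list G, generates S /\ hyperbolic_wrt S.

Definition is_aut (f : G -> G) : Prop :=
  (forall x y, f (mul x y) = mul (f x) (f y)) /\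
  (forall x y, f x = f y -> x = y) /\ (forall y, exists x, f x = y).

Definition out_equiv (f g : G -> G) : Prop :=
  exists h, forall x, f x = mul (mul h (g x)) (inv h).

Definition Out_infinite : Prop :=
  ~ exists L : list (G -> G), Forall is_aut L /\
      forall f, is_aut f -> exists g, In g L /\ out_equiv f g.

(* translation length l_S(x) = min_h |h x h^{-1}|_S is >= M *)
Definition transl_len_ge (S : list G) (x : G) (M : nat) : Prop :=
  forall h n, word_len_le S (mul (mul h x) (inv h)) n -> M <= n.

Definition in_BS (S : list G) (b : G) : Prop :=
  In b S \/ exists s s', In s S /\ In s' S /\ s <> s' /\ b = mul s s'.

End GroupDefs.

(* Main.v *)
Require Import Defs.
From Stdlib Require Import List Arith ZArith.
From Stdlib Require Import Lia Classical IndefiniteDescription Wf_nat FinFun.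
Import ListNotations.
Set Implicit Arguments.

(** Suppose the translation lengths of all [phi n b], [b] in [B_S], are at most [M]
    for large [n]. In a hyperbolic metric, if a point [x] is moved far by some of the
    isometries [phi n s], [s] in [S], then the bounds on the translation lengths of these
    isometries and of their products force all the geodesics from [x] to its images and
    preimages under them to share a long initial segment. Moving [x] a bounded
    distance along that segment decreases the maximal displacement, so some point is
    moved at most [K(M, delta)] by every [phi n s]. Conjugating by that point puts the
    tuple [(phi n s)_s] in a fixed finite set, and two of the [phi n] coincide in [Out]. *)

(** * Displacement in four-point hyperbolic spaces *)

Section Displacement.
Context (X : Type) (d : X -> X -> nat) (delta : nat).
Context (d_sym : forall x y, d x y = d y x)
  (d_triangle : forall x y z, d x z <= d x y + d y z)
  (d_geodesic : forall x y t, t <= d x y ->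
     exists z, d x z = t /\ d z y = d x y - t)
  (four_point : forall x y z w,
     d x y + d z w <= Nat.max (d x z + d y w) (d x w + d y z) + 2 * delta).

Definition isometry (f : X -> X) : Prop :=
  (forall x y, d (f x) (f y) = d x y) /\ (forall y, exists x, f x = y).

Lemma isometry_comp (f h : X -> X) :
  isometry f -> isometry h -> isometry (fun x => f (h x)).
Proof.
  intros [Hf sf] [Hh sh]; split.
  - intros x y; rewrite Hf; apply Hh.
  - intros y; destruct (sf y) as [u <-], (sh u) as [v <-]; now exists v.
Qed.

(** In the four-point inequality for [x], [f (f x)], [f x], [f p], both sums under the maximum are
    at most [d x (f x) + d x p + M], and [d x p] cancels against [d (f x) (f p)]. *)
Lemma displacement_sqr (f : X -> X) (M : nat) (p x : X) :
  isometry f -> d p (f p) <= M ->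
  d x (f (f x)) <= d x (f x) + M + 2 * delta.
Proof.
  intros [Hf _] Hp.
  pose proof (four_point x (f (f x)) (f x) (f p)) as H4.
  pose proof (d_triangle (f x) (f p) p) as T1.
  pose proof (d_triangle x p (f p)) as T2.
  rewrite !Hf, (d_sym (f x) x) in H4.
  rewrite Hf, (d_sym (f p) p) in T1.
  lia.
Qed.

(* The conclusion says that the Gromov product of the preimage of [x] under [f] and of
   [h x], based at [x], is at least [r]. Otherwise [x, f x, f h x, f h f x, f h f h x]
   would be a local quasi-geodesic, against the small translation length of [f h]. *)
Lemma displacement_mul (f h : X -> X) (M r : nat) (x : X) :
  isometry f -> isometry h ->
  (exists p, d p (f p) <= M) -> (exists p, d p (h p) <= M) ->
  (exists p, d p (f (h p)) <= M) ->
  M + 4 * r + 10 * delta < d x (f x) ->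
  M + 4 * r + 10 * delta < d x (h x) ->
  d x (f (h x)) + 2 * r <= d x (f x) + d x (h x).
Proof.
  intros If Ih [p Hp] [q Hq] [m Hm] La Lb.
  pose proof (displacement_sqr x If Hp) as Qf.
  pose proof (displacement_sqr x Ih Hq) as Qh.
  pose proof (displacement_sqr x (isometry_comp If Ih) Hm) as Qfh.
  cbv beta in Qfh.
  destruct If as [Hf sf], Ih as [Hh sh].
  destruct (sf x) as [z Hz], (sh x) as [w Hw].
  assert (Ez : forall y, d z y = d x (f y)) by (intro y; rewrite <- (Hf z y), Hz; easy).
  assert (Ew : forall y, d w y = d x (h y)) by (intro y; rewrite <- (Hh w y), Hw; easy).
  (* Write [a], [b] for the displacements of [x] under [f], [h], and suppose [d x (f (h x))] exceeds
     [a + b - 2 * r]. Then [A1] and [A2] make [d (f x) (h x)] and [d x (h (f x))] almost as large,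
     losing [2 * delta] each time. By [A3], [d x (f (h (f x)))] exceeds
     [2 * a + b - 4 * r - 6 * delta], whereas [A4] and [Qfh] bound it by the larger of
     [a + M + 4 * delta] and [b + 2 * delta]. *)
  pose proof (four_point z (h x) x (f x)) as A1.
  pose proof (four_point (f x) (h x) x w) as A2.
  pose proof (four_point x (f (h x)) (f x) (f (h (f x)))) as A3.
  pose proof (four_point x (f (h (f x))) (f (h x)) (f (h (f (h x))))) as A4.
  rewrite (d_sym (h x) w), (d_sym (f x) w), (d_sym x w) in A2.
  rewrite (d_sym (h x) x), (d_sym (f x) x) in A2.
  rewrite (d_sym (h x) x), (d_sym (h x) (f x)) in A1.
  rewrite (d_sym (f (h x)) (f x)) in A3.
  rewrite (d_sym (f (h (f x))) (f (h x))) in A4.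
  rewrite !Ez in A1; rewrite !Ew in A2.
  rewrite ?Hf, ?Hh, ?Hf in A3; rewrite ?Hf, ?Hh, ?Hf in A4.
  lia.
Qed.

Lemma displacement_decrease (F : list (X -> X)) (M L : nat) (x : X) :
  (forall f, In f F -> isometry f) ->
  (forall f, In f F -> exists p, d p (f p) <= M) ->
  (forall f h, In f F -> In h F -> f <> h -> exists p, d p (f (h p)) <= M) ->
  M + 40 * delta + 10 < L ->
  (forall f, In f F -> d x (f x) <= L) ->
  exists y, forall f, In f F -> d y (f y) <= L - 1.
Proof.
  intros HI H1 H2 HL Hx.
  (* For a nearly maximal displacement, [d y (h x)] and [d x (h y)] will each be at most
     [d x (h x) - t + 2 * delta], and the last four-point inequality costs [2 * delta] more. The
     total gain [2 * t - 6 * delta] must be positive. *)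
  set (t := 3 * delta + 1).
  (* The margin [delta] beyond [t] is spent in [Yh]. The case [f = h], which [H2] does not cover,
     follows from [displacement_sqr]. *)
  assert (Hmul : forall f h, In f F -> In h F ->
    L <= d x (f x) + 2 * t -> L <= d x (h x) + 2 * t ->
    d x (f (h x)) + 2 * (t + delta) <= d x (f x) + d x (h x)).
  { intros f h Hf Hh Lf Lh.
    destruct (classic (f = h)) as [<- | Hne].
    - destruct (H1 f Hf) as [p Hp].
      pose proof (displacement_sqr x (HI f Hf) Hp). subst t; lia.
    - apply displacement_mul with M; auto; subst t; lia. }
  (* Moving [x] by [t] raises a displacement by at most [2 * t], so only isometries within [2 * t]
     of the bound [L] are delicate. *)
  destruct (classic (exists f, In f F /\ L <= d x (f x) + 2 * t)) as [[f [Hf Lf]] | Hno].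
  2: { exists x; intros f Hf.
       destruct (le_lt_dec L (d x (f x) + 2 * t)).
       - now exfalso; apply Hno; exists f.
       - subst t; lia. }
  destruct (@d_geodesic x (f x) t) as [y [Hxy Hyf]]; [subst t; lia|].
  exists y; intros h Hh.
  destruct (HI f Hf) as [If sf], (HI h Hh) as [Ih sh].
  destruct (le_lt_dec L (d x (h x) + 2 * t)) as [Lh | Lh].
  2: { pose proof (d_triangle y x (h y)) as T1.
       pose proof (d_triangle x (h x) (h y)) as T2.
       rewrite Ih in T2; rewrite (d_sym y x) in T1; lia. }
  destruct (sf x) as [z Hz], (sh x) as [w Hw].
  assert (Ez : forall u, d z u = d x (f u)) by (intro u; rewrite <- (If z u), Hz; easy).
  assert (Ew : forall u, d w u = d x (h u)) by (intro u; rewrite <- (Ih w u), Hw; easy).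
  pose proof (Hmul f f Hf Hf Lf Lf).
  pose proof (Hmul f h Hf Hh Lf Lh).
  pose proof (Hmul h f Hh Hf Lh Lf).
  (* The premise says that the Gromov product of [u] and [f x] at [x] is at least [t]: a step of
     length [t] towards [f x] is then also a step towards [u]. *)
  assert (toward : forall u, d u (f x) + 2 * t <= d x u + d x (f x) ->
    d y u + t <= d x u + 2 * delta).
  { intros u Hu.
    pose proof (four_point y u x (f x)) as A.
    rewrite (d_sym y x), (d_sym u x) in A. lia. }
  (* Both [h x] and [f x] have Gromov product at least [t + delta] with the preimage [z], hence at
     least [t] with each other. *)
  assert (Yh : d y (h x) + t <= d x (h x) + 2 * delta).
  { apply toward.
    pose proof (four_point (h x) (f x) x z) as A.
    rewrite (d_sym (h x) x), (d_sym (h x) z), (d_sym (f x) x), (d_sym (f x) z),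
      (d_sym x z), !Ez in A. lia. }
  assert (Yw : d y w + t <= d x w + 2 * delta).
  { apply toward. rewrite (d_sym x w), !Ew. lia. }
  rewrite (d_sym y w), (d_sym x w), !Ew in Yw.
  pose proof (four_point y (h y) x (h x)) as A.
  rewrite (d_sym y x), Ih, (d_sym y x), (d_sym (h y) x) in A.
  pose proof (Hx h Hh); subst t; lia.
Qed.

(** Displacements are natural numbers, so iterating [displacement_decrease] from any starting point
    reaches the threshold. *)
Theorem bounded_common_displacement (F : list (X -> X)) (M : nat) (x0 : X) :
  (forall f, In f F -> isometry f) ->
  (forall f, In f F -> exists p, d p (f p) <= M) ->
  (forall f h, In f F -> In h F -> f <> h -> exists p, d p (f (h p)) <= M) ->
  exists y, forall f, In f F -> d y (f y) <= M + 40 * delta + 10.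
Proof.
  intros HI H1 H2.
  assert (descent : forall L x, (forall f, In f F -> d x (f x) <= L) ->
    exists y, forall f, In f F -> d y (f y) <= M + 40 * delta + 10).
  { induction L as [|L IH]; intros x Hx.
    - exists x; intros f Hf; specialize (Hx f Hf); lia.
    - destruct (le_lt_dec (S L) (M + 40 * delta + 10)) as [HL | HL].
      + exists x; intros f Hf; specialize (Hx f Hf); lia.
      + destruct (displacement_decrease F HI H1 H2 HL Hx) as [y Hy].
        apply (IH y). now simpl in Hy; rewrite Nat.sub_0_r in Hy. }
  apply (descent (list_max (map (fun f => d x0 (f x0)) F)) x0).
  intros f Hf.
  assert (HF := proj1 (list_max_le _ _) (le_n (list_max (map (fun f => d x0 (f x0)) F)))).
  rewrite Forall_forall in HF; apply HF.
  now apply (in_map (fun f => d x0 (f x0))).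
Qed.

End Displacement.

(** * Finiteness *)

Lemma pigeonhole_nat (A : Type) (l : list A) (f : nat -> A) :
  (forall n, In (f n) l) -> exists n m, n <> m /\ f n = f m.
Proof.
  intros Hl; apply NNPP; intros Hno.
  assert (Hinj : Injective f).
  { intros n m E; apply NNPP; intros Hne; apply Hno; now exists n, m. }
  assert (Hlen : length (map f (seq 0 (S (length l)))) <= length l).
  { apply NoDup_incl_length.
    - apply Injective_map_NoDup; [exact Hinj | apply seq_NoDup].
    - intros a Ha; apply in_map_iff in Ha; destruct Ha as [n [<- _]]; apply Hl. }
  rewrite length_map, length_seq in Hlen; lia.
Qed.

Lemma finite_tuples (A : Type) (l : list A) (k : nat) :
  exists T : list (list A), forall u, length u = k -> Forall (fun a => In a l) u -> In u T.
Proof.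
  induction k as [|k [T HT]].
  - exists [[]]; intros [|a u] Hu _; [now left | discriminate].
  - exists (map (fun p => fst p :: snd p) (list_prod l T)).
    intros [|a u] Hu HF; [discriminate|].
    inversion_clear HF.
    apply in_map_iff; exists (a, u); split; [easy|].
    apply in_prod; auto.
Qed.

(** In the final proof the two bounds are a word length and an index threshold; [wlen_change] uses
    only the first. *)
Lemma uniform_bounds (A : Type) (l : list A) (P : A -> nat -> nat -> Prop) :
  (forall a M N M' N', P a M N -> M <= M' -> N <= N' -> P a M' N') ->
  (forall a, In a l -> exists M N, P a M N) ->
  exists M N, forall a, In a l -> P a M N.
Proof.
  intros Hmono; induction l as [|a l IH]; intros Hl.
  - exists 0, 0; intros a [].
  - destruct (Hl a (or_introl eq_refl)) as (M1 & N1 & H1).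
    destruct IH as (M2 & N2 & H2); [intros b Hb; apply Hl; now right|].
    exists (Nat.max M1 M2), (Nat.max N1 N2).
    intros b [<- | Hb].
    + apply Hmono with M1 N1; auto; lia.
    + apply Hmono with M2 N2; auto; lia.
Qed.

(** * Word metrics *)

Section WordMetric.
Context (G : Type) (mul : G -> G -> G) (inv : G -> G) (e : G).
Context (HG : is_group mul inv e).

Local Infix "*" := mul.
Local Notation "x ^-1" := (inv x) (at level 3, format "x ^-1").
Local Notation wlen := (word_len_le mul inv e).

Let mulA x y z : x * (y * z) = x * y * z.
Proof. apply HG. Qed.
Let mul1g x : e * x = x.
Proof. apply HG. Qed.
Let mulg1 x : x * e = x.
Proof. apply HG. Qed.
Let mulVg x : x^-1 * x = e.
Proof. apply HG. Qed.
Let mulgV x : x * x^-1 = e.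
Proof. apply HG. Qed.

Lemma mulKg x y : x^-1 * (x * y) = y.
Proof. now rewrite mulA, mulVg, mul1g. Qed.

Lemma mulVKg x y : x * (x^-1 * y) = y.
Proof. now rewrite mulA, mulgV, mul1g. Qed.

Lemma inv_unique x y : x * y = e -> y = x^-1.
Proof. intros H. now rewrite <- (mulKg x y), H, mulg1. Qed.

Lemma invgK x : x^-1^-1 = x.
Proof. symmetry; apply inv_unique, mulVg. Qed.

Lemma invMg x y : (x * y)^-1 = y^-1 * x^-1.
Proof. symmetry; apply inv_unique. now rewrite <- mulA, mulVKg. Qed.

Lemma wlen_weaken S g n m : wlen S g n -> n <= m -> wlen S g m.
Proof. intros (l & Hl & H) Hnm; exists l; split; [lia | exact H]. Qed.

Lemma wprod_app l l' : wprod mul e (l ++ l') = wprod mul e l * wprod mul e l'.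
Proof.
  induction l as [|a l IH]; simpl; [easy|].
  unfold wprod in *; now rewrite IH, mulA.
Qed.

Lemma wlen_1 S n : wlen S e n.
Proof. exists []; repeat split; [simpl; lia | constructor]. Qed.

Lemma wlen_mul S g h n m : wlen S g n -> wlen S h m -> wlen S (g * h) (n + m).
Proof.
  intros (l & Hl & Fl & <-) (l' & Hl' & Fl' & <-).
  exists (l ++ l'); rewrite length_app, wprod_app, Forall_app; repeat split; auto; lia.
Qed.

Lemma wlen_inv S g n : wlen S g n -> wlen S g^-1 n.
Proof.
  intros (l & Hl & Fl & <-); revert n Hl.
  induction l as [|a l IH]; intros n Hl; simpl.
  - rewrite <- (inv_unique (mul1g e)); apply wlen_1.
  - inversion_clear Fl as [|? ? Ha Fl'].
    simpl in Hl. change (fold_right mul e l) with (wprod mul e l).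
    rewrite invMg.
    replace n with ((n - 1) + 1) by lia.
    apply wlen_mul; [apply IH; auto; lia|].
    exists [a^-1]; repeat split; [auto | | apply mulg1].
    constructor; [|constructor].
    rewrite invgK; tauto.
Qed.

(** Hyperbolicity is given for some generating set, translation lengths are taken in another.
    Transferring length bounds avoids showing that hyperbolicity is independent of the
    generators. *)
Lemma wlen_change S T : generates mul inv e T ->
  exists C, forall g n, wlen S g n -> wlen T g (Nat.mul C n).
Proof.
  intros HT.
  destruct (uniform_bounds S (fun s C _ => wlen T s C)) as (C & _ & HC).
  - intros; eapply wlen_weaken; eauto.
  - intros s _; destruct (HT s) as [n Hn]; now exists n, 0.
  - exists C; intros g n (l & Hl & Fl & <-); revert n Hl.
    induction l as [|a l IH]; intros n Hl; [apply wlen_1|].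
    inversion_clear Fl as [|? ? Ha Fl']. simpl in Hl.
    apply wlen_weaken with (C + Nat.mul C (n - 1)); [|nia].
    apply (@wlen_mul T a (wprod mul e l)); [|apply IH; auto; lia].
    destruct Ha as [Ha | Ha]; [auto|].
    rewrite <- (invgK a); apply wlen_inv; auto.
Qed.

Lemma ball_finite S n : exists B, forall g, wlen S g n -> In g B.
Proof.
  induction n as [|n [B HB]].
  - exists [e]; intros g (l & Hl & _ & <-).
    destruct l; [now left | simpl in Hl; lia].
  - exists (e :: map (fun p => fst p * snd p) (list_prod (S ++ map inv S) B)).
    intros g (l & Hl & Fl & <-).
    destruct l as [|a l]; [now left|right].
    inversion_clear Fl as [|? ? Ha Fl'].
    apply in_map_iff; exists (a, wprod mul e l); split; [easy|].
    apply in_prod.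
    + apply in_app_iff; destruct Ha as [Ha | Ha]; [now left|right].
      rewrite <- (invgK a); now apply in_map.
    + apply HB; exists l; repeat split; auto; simpl in Hl; lia.
Qed.

Lemma dist_exists S : generates mul inv e S ->
  exists d : G -> G -> nat, forall x y, is_dist mul inv e S x y (d x y).
Proof.
  intros HS.
  assert (H : forall x y, exists n, is_dist mul inv e S x y n).
  { intros x y.
    destruct (dec_inh_nat_subset_has_unique_least_element (wlen S (x^-1 * y)))
      as (n & Hn & _); [intros; apply classic | apply HS | now exists n]. }
  exists (fun x y => proj1_sig (constructive_indefinite_description _ (H x y))).
  intros x y; apply proj2_sig.
Qed.

Section Dist.
Context (S : list G) (d : G -> G -> nat).
Context (Hd : forall x y, is_dist mul inv e S x y (d x y)).

Lemma dist_wlen x y : wlen S (x^-1 * y) (d x y).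
Proof. apply Hd. Qed.

Lemma dist_le x y n : wlen S (x^-1 * y) n -> d x y <= n.
Proof. apply Hd. Qed.

Lemma dist_sym x y : d x y = d y x.
Proof.
  assert (H : forall a b, d a b <= d b a); [|now apply Nat.le_antisymm].
  intros a b; apply dist_le.
  rewrite <- (invgK (a^-1 * b)), invMg, invgK.
  apply wlen_inv, dist_wlen.
Qed.

Lemma dist_triangle x y z : d x z <= d x y + d y z.
Proof.
  apply dist_le.
  replace (x^-1 * z) with ((x^-1 * y) * (y^-1 * z)) by now rewrite <- mulA, mulVKg.
  apply wlen_mul; apply dist_wlen.
Qed.

Lemma dist_mull g x y : d (g * x) (g * y) = d x y.
Proof.
  assert (E : (g * x)^-1 * (g * y) = x^-1 * y) by now rewrite invMg, <- mulA, mulKg.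
  apply Nat.le_antisymm; apply dist_le; [rewrite E | rewrite <- E]; apply dist_wlen.
Qed.

(** Cut a shortest word after [t] letters; the triangle inequality turns both upper bounds into
    equalities. *)
Lemma dist_geodesic x y t : t <= d x y ->
  exists z, d x z = t /\ d z y = Nat.sub (d x y) t.
Proof.
  intros Ht.
  destruct (dist_wlen x y) as (l & Hl & Fl & El).
  rewrite <- (firstn_skipn t l) in Fl, El.
  rewrite Forall_app in Fl; destruct Fl as [F1 F2].
  rewrite wprod_app in El.
  set (a := wprod mul e (firstn t l)) in *.
  set (b := wprod mul e (skipn t l)) in *.
  assert (H1 : d x (x * a) <= t).
  { apply dist_le; rewrite mulKg.
    exists (firstn t l); repeat split; auto. apply firstn_le_length. }
  assert (H2 : d (x * a) y <= Nat.sub (d x y) t).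
  { apply dist_le.
    replace ((x * a)^-1 * y) with b by now rewrite invMg, <- mulA, <- El, mulKg.
    exists (skipn t l); repeat split; auto. rewrite length_skipn; lia. }
  exists (x * a); pose proof (dist_triangle x (x * a) y); lia.
Qed.

(** Subtracting the Gromov product inequality from the sum of the three distances to [w] turns its
    minimum into a maximum. *)
Lemma dist_four_point : hyperbolic_wrt mul inv e S ->
  exists delta : nat, forall x y z w,
    d x y + d z w <=
    Nat.max (d x z + d y w) (d x w + d y z) + Nat.mul 2 delta.
Proof.
  intros [delta H]; exists delta; intros x y z w.
  specialize (H x y z w _ _ _ _ _ _ (Hd x w) (Hd y w) (Hd z w) (Hd x y) (Hd x z) (Hd y z)).
  lia.
Qed.

Lemma isometry_mull g : isometry d (mul g).
Proof.
  split; [apply dist_mull|].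
  intros y; exists (g^-1 * y); apply mulVKg.
Qed.

End Dist.

(** Left translation by [g] is an isometry, and the length of [h * g * h^-1] is its displacement at
    [h^-1]. Since [K] is chosen before [F], one ball will serve for all the automorphisms. *)
Lemma bounded_common_conjugator S : generates mul inv e S -> hyperbolic_wrt mul inv e S ->
  forall M, exists K, forall F : list G,
    (forall g, In g F -> exists h, wlen S (h * g * h^-1) M) ->
    (forall g g', In g F -> In g' F -> g <> g' -> exists h, wlen S (h * (g * g') * h^-1) M) ->
    exists x, forall g, In g F -> wlen S (x^-1 * g * x) K.
Proof.
  intros HS Hhyp M.
  destruct (dist_exists HS) as [d Hd].
  destruct (dist_four_point _ Hd Hhyp) as [delta H4].
  exists (Nat.add M (Nat.add (Nat.mul 40 delta) 10)).
  intros F H1 H2.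
  assert (Hdisp : forall g, (exists h, wlen S (h * g * h^-1) M) -> exists p, d p (g * p) <= M).
  { intros g [h Hh]; exists h^-1; apply (dist_le _ Hd).
    now rewrite invgK, mulA. }
  destruct (bounded_common_displacement delta (dist_sym _ Hd) (dist_triangle _ Hd)
    (dist_geodesic _ Hd) H4 (map mul F) (M := M) e) as [x Hx].
  - intros f Hf; apply in_map_iff in Hf; destruct Hf as [g [<- _]].
    apply (isometry_mull _ Hd).
  - intros f Hf; apply in_map_iff in Hf; destruct Hf as [g [<- Hg]]; auto.
  - intros f f' Hf Hf' Hne.
    apply in_map_iff in Hf; destruct Hf as [g [<- Hg]].
    apply in_map_iff in Hf'; destruct Hf' as [g' [<- Hg']].
    destruct (Hdisp (g * g')) as [p Hp].
    + apply H2; auto; intros ->; now apply Hne.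
    + exists p; now rewrite mulA.
  - exists x; intros g Hg.
    rewrite <- mulA.
    apply wlen_weaken with (d x (g * x)); [apply (dist_wlen _ Hd)|].
    specialize (Hx (mul g) (in_map mul F g Hg)); lia.
Qed.

Lemma hom_eq_on_generators (f g : G -> G) S : generates mul inv e S ->
  (forall x y, f (x * y) = f x * f y) -> (forall x y, g (x * y) = g x * g y) ->
  (forall s, In s S -> f s = g s) -> forall x, f x = g x.
Proof.
  intros HS Hf Hg Hfg x.
  assert (hom1 : forall k : G -> G, (forall x y, k (x * y) = k x * k y) -> k e = e).
  { intros k Hk; rewrite <- (mulKg (k e) (k e)), <- Hk, mul1g; apply mulVg. }
  assert (homV : forall k : G -> G, (forall x y, k (x * y) = k x * k y) ->
    forall y, k y = (k y^-1)^-1).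
  { intros k Hk y; apply inv_unique; now rewrite <- Hk, mulVg, hom1. }
  destruct (HS x) as (n & l & _ & Fl & <-); clear n.
  induction Fl as [|a l Ha Fl IH]; simpl.
  - now rewrite !hom1.
  - change (fold_right mul e l) with (wprod mul e l).
    rewrite Hf, Hg, IH; f_equal.
    destruct Ha as [Ha | Ha]; [auto|].
    now rewrite (homV f), (homV g), Hfg.
Qed.

End WordMetric.

(** * Coincidences among outer automorphisms *)

Theorem mainTheorem5 (G : Type) (mul : G -> G -> G) (inv : G -> G) (e : G)
  (HG : is_group mul inv e)
  (Hhyp : hyperbolic_group mul inv e)
  (Hout : Out_infinite mul inv)
  (S : list G) (HS : generates mul inv e S)
  (phi : nat -> G -> G)
  (Haut : forall n, is_aut mul (phi n))
  (Hdist : forall n m, n <> m -> ~ out_equiv mul inv (phi n) (phi m)) :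
  exists b, in_BS mul S b /\
    forall M N : nat, exists n, N <= n /\ transl_len_ge mul inv e S (phi n b) M.
Proof.
  apply NNPP; intros Hno.
  destruct Hhyp as [T [HT HypT]].
  destruct (wlen_change HG S HT) as [C HC].
  (* The list below contains all products of two generators, squares included; the guard [in_BS]
     makes [P] vacuous outside the test set. *)
  pose (P b M N := in_BS mul S b -> forall n, N <= n ->
    exists h, word_len_le mul inv e T (mul (mul h (phi n b)) (inv h)) M).
  assert (Hbd : exists M N, forall b, In b (S ++ map (fun p => mul (fst p) (snd p)) (list_prod S S)) ->
    P b M N).
  { apply uniform_bounds.
    - intros b M N M' N' H HM HN Hb n Hn.
      destruct (H Hb n (Nat.le_trans _ _ _ HN Hn)) as [h Hh].
      exists h; eapply wlen_weaken; eauto.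
    - intros b _.
      destruct (classic (in_BS mul S b)) as [Hb | Hb]; [|now exists 0, 0].
      apply NNPP; intros Hunb; apply Hno; exists b; split; [exact Hb|].
      intros M N; apply NNPP; intros Hlen; apply Hunb.
      exists (C * M), N; intros _ n Hn.
      apply NNPP; intros Hh; apply Hlen; exists n; split; [exact Hn|].
      intros h k Hk; destruct (le_lt_dec M k) as [|Hlt]; [assumption|].
      exfalso; apply Hh; exists h; apply HC.
      eapply wlen_weaken; [exact Hk | lia]. }
  destruct Hbd as (M & N & Hbd).
  destruct (bounded_common_conjugator HG HT HypT M) as [K HK].
  assert (Hconj : forall n, exists x, forall s, In s S ->
    word_len_le mul inv e T (mul (mul (inv x) (phi (N + n) s)) x) K).
  { intros n.
    destruct (HK (map (phi (N + n)) S)) as [x Hx].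
    - intros g Hg; apply in_map_iff in Hg; destruct Hg as [s [<- Hs]].
      apply (Hbd s); [apply in_app_iff; now left | now left | lia].
    - intros g g' Hg Hg' Hne.
      apply in_map_iff in Hg; destruct Hg as [s [<- Hs]].
      apply in_map_iff in Hg'; destruct Hg' as [s' [<- Hs']].
      rewrite <- (proj1 (Haut (N + n))).
      apply (Hbd (mul s s')); [| |lia].
      + apply in_app_iff; right; apply in_map_iff.
        exists (s, s'); split; [easy | now apply in_prod].
      + right; exists s, s'; repeat split; auto; now intros ->.
    - exists x; intros s Hs; apply Hx; now apply in_map. }
  (* Each [psi n] lies in the outer class of [phi (N + n)] and maps [S] into the fixed ball of
     radius [K] for [T], so the tuples of images of [S] are finite in number. *)
  pose (x n := proj1_sig (constructive_indefinite_description _ (Hconj n))).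
  pose (psi n g := mul (mul (inv (x n)) (phi (N + n) g)) (x n)).
  assert (Hpsi : forall n s, In s S -> word_len_le mul inv e T (psi n s) K).
  { intros n; exact (proj2_sig (constructive_indefinite_description _ (Hconj n))). }
  destruct (ball_finite HG T K) as [B HB].
  destruct (finite_tuples B (length S)) as [U HU].
  destruct (pigeonhole_nat U (fun n => map (psi n) S)) as (n & m & Hnm & E).
  { intros n; apply HU; [apply length_map|].
    apply Forall_forall; intros g Hg; apply in_map_iff in Hg; destruct Hg as [s [<- Hs]].
    now apply HB, Hpsi. }
  apply (Hdist (N + n) (N + m)); [lia|].
  pose proof HG as (mulA & mul1g & mulg1 & mulVg & mulgV).
  assert (psi_hom : forall k a b, psi k (mul a b) = mul (psi k a) (psi k b)).
  { intros k a b; unfold psi; rewrite (proj1 (Haut (N + k))), !mulA.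
    do 2 f_equal.
    now rewrite <- (mulA _ (x k) (inv (x k))), mulgV, mulg1. }
  assert (Epsi : forall g, psi n g = psi m g).
  { apply (hom_eq_on_generators HG (psi n) (psi m) HS); auto.
    intros s Hs; exact (ext_in_map E s Hs). }
  (* Conjugation by [x n] takes [psi n], which equals [psi m], to [phi (N + n)], and conjugation by
     [inv (x m)] takes [phi (N + m)] to [psi m]. *)
  exists (mul (x n) (inv (x m))); intros g.
  assert (Ephi : phi (N + n) g = mul (mul (x n) (psi n g)) (inv (x n))).
  { unfold psi. rewrite !mulA, mulgV, mul1g, <- mulA, mulgV, mulg1; easy. }
  rewrite Ephi, Epsi; unfold psi.
  rewrite (invMg HG), (invgK HG), !mulA; easy.
Qed.
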